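(* Let $\Lambda\subset\mathbb R^2$ be a unimodular lattice, $\tau>0$ with $\mathcal F(\Lambda,\tau)\ne\emptyset$, and let $\begin{pmatrix}q_1 \\ a_1\end{pmatrix},\begin{pmatrix}q_2 \\ a_2\end{pmatrix}$ be two points in $\mathcal F(\Lambda,\tau)$ with consecutive slopes. Then: (a) $0<q_1,q_2\le\tau$. (b) There are no points of $\Lambda$ in the interior of the triangle bounded by the lines $y=\frac{a_1}{q_1}x$, $y=\frac{a_2}{q_2}x$ and $x=\tau$. (c) $q_1+q_2>\tau$. (d) The vectors $\begin{pmatrix}q_1 \\ a_1\end{pmatrix}$ and $\begin{pmatrix}q_2 \\ a_2\end{pmatrix}$ form a positively oriented basis of the lattice $\Lambda$. (e) $a_2q_1-a_1q_2=1$; equivalently, $\dfrac{a_2}{q_2}=\dfrac{a_1}{q_1}+\dfrac1{q_1q_2}$.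
   Context: A unimodular lattice has covolume $1$. A nonzero $v\in\Lambda$ is primitive if the only lattice point in $\{rv\mid r\in[0,1)\}$ is the origin; $\Lambda_{\mathrm{prim}}$ is the set of primitive points. $S_\tau=(0,\tau]\times\mathbb R$ and $\mathcal F(\Lambda,\tau)=\Lambda_{\mathrm{prim}}\cap S_\tau$. Two points $\begin{pmatrix}q_1 \\ a_1\end{pmatrix},\begin{pmatrix}q_2 \\ a_2\end{pmatrix}\in\mathcal F(\Lambda,\tau)$ have consecutive slopes if $\frac{a_1}{q_1}<\frac{a_2}{q_2}$ and there is no $\begin{pmatrix}q' \\ a'\end{pmatrix}\in\mathcal F(\Lambda,\tau)$ with $\frac{a_1}{q_1}<\frac{a'}{q'}<\frac{a_2}{q_2}$. *)

(* Defs.v *)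
From HB Require Import structures.
From mathcomp Require Import all_boot all_order all_algebra.
From mathcomp Require Import all_classical all_reals all_analysis.
Set Implicit Arguments.
Unset Strict Implicit.
Unset Printing Implicit Defensive.
Import Order.TTheory GRing.Theory Num.Theory.
Import numFieldNormedType.Exports.
Local Open Scope classical_set_scope.
Local Open Scope ring_scope.

Section Lattices.
Variable R : realType.
Implicit Types (L : set 'cV[R]_2) (B : 'M[R]_2) (u v w : 'cV[R]_2).

Definition int_mx m n (z : 'M[int]_(m, n)) : 'M[R]_(m, n) := map_mx intr z.

(* The columns of B are a basis of R^2 whose Z-span is L. *)
Definition lattice_basis L B : Prop :=
  B \in unitmx /\ L = range (fun z : 'cV[int]_2 => B *m int_mx z).

(* A lattice in R^2 is the Z-span of a basis of R^2; its covolume is the area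
   of the parallelogram spanned by any of its bases. *)
Definition lattice L : Prop := exists B, lattice_basis L B.

Definition has_covolume L (c : R) : Prop :=
  exists2 B, lattice_basis L B & `|\det B| = c.

Definition unimodular_lattice L : Prop := lattice L /\ has_covolume L 1.

Lemma lattice_basis_change L B B' :
  lattice_basis L B -> lattice_basis L B' ->
  exists U : 'M[int]_2, B' = B *m int_mx U.
Proof.
move=> [_ LB] [_ LB'].
have colB' j : exists z : 'cV[int]_2, B *m int_mx z = col j B'.
  have : L (col j B').
    by rewrite LB' colE; exists (delta_mx j 0) => //; rewrite /int_mx map_delta_mx.
  by rewrite LB => -[z _ zE]; exists z.
have [f fE] := choice colB'.
exists (\matrix_(i, j) f j i 0).
apply/matrixP => i j; have /matrixP/(_ i 0) := fE j.
by rewrite !mxE => <-; apply: eq_bigr => k _; rewrite !mxE.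
Qed.

Lemma has_covolume_unique L (c c' : R) :
  has_covolume L c -> has_covolume L c' -> c = c'.
Proof.
move=> [B LB <-] [B' LB' <-].
have [U BU] := lattice_basis_change LB LB'.
have [V BV] := lattice_basis_change LB' LB.
have [uB _] := LB.
have BUV : B *m (int_mx U *m int_mx V) = B by rewrite mulmxA -BU -BV.
have UV : \det U * \det V = 1.
  apply: (@intr_inj R); rewrite rmorphM /= -!det_map_mx -det_mulmx.
  by rewrite -[_ *m _](mulKmx uB) BUV mulVmx // det1.
have U1 : `|\det U| = 1.
  have : \det U \is a GRing.unit by apply/unitrPr; exists (\det V).
  by move=> /orP[] /eqP ->.
by rewrite BU det_mulmx normrM det_map_mx -intr_norm U1 mulr1.
Qed.

Definition primitive L v : Prop :=
  [/\ L v, v != 0 & L `&` [set r *: v | r in `[0, 1[] = [set 0]].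

Definition strip (tau : R) : set 'cV[R]_2 := [set v | 0 < v 0 0 <= tau].

Definition farey_points L (tau : R) : set 'cV[R]_2 :=
  [set v | primitive L v] `&` strip tau.

Definition vec2 (q a : R) : 'cV[R]_2 := \col_(i < 2) [:: q; a]`_i.

Definition slope v : R := v 1 0 / v 0 0.

Definition consecutive_slopes L (tau : R) v w : Prop :=
  [/\ farey_points L tau v, farey_points L tau w, slope v < slope w &
      ~ exists2 u, farey_points L tau u & slope v < slope u < slope w].

(* The closed triangle cut out by the lines y = s x, y = t x and x = tau,
   for s < t and 0 < tau. *)
Definition triangle (s t tau : R) : set 'cV[R]_2 :=
  [set p | s * p 0 0 <= p 1 0 <= t * p 0 0 /\ 0 <= p 0 0 <= tau].

Definition positively_oriented_basis L v w : Prop :=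
  lattice_basis L (row_mx v w) /\ 0 < \det (row_mx v w : 'M[R]_2).

End Lattices.

(* Main.v *)
(* Every nonzero lattice point is a positive integer multiple of a primitive
   one on the same ray, so no lattice point of the strip, primitive or not, has
   slope strictly between those of v and w; this gives (b) and, applied to
   v + w, (c).  The determinant n of (v, w) is a positive integer, and
   primitivity of v gives (Bezout) a lattice point u with det(v, u) = 1.
   Translating u by a multiple of v we may write u = (r/n) v + (1/n) w with
   0 <= r < n.  If n > 1, then either r = 0 and w/n lies in the lattice, against
   primitivity of w, or u has intermediate slope and abscissa at most
   max(q1, q2) <= tau.  Hence n = 1. *)
Require Import Defs.
From HB Require Import structures.
From mathcomp Require Import all_boot all_order all_algebra.
From mathcomp Require Import all_classical all_reals all_analysis.
From mathcomp Require Import zify ring lra.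
Import Order.TTheory GRing.Theory Num.Theory.
Import numFieldNormedType.Exports.
Local Open Scope classical_set_scope.
Local Open Scope ring_scope.

(** The determinant with columns [u] and [v], over any ring so that it serves integer coordinate
    vectors as well as points of the plane. *)
Definition cross {R : pzRingType} (u v : 'cV[R]_2) : R :=
  u 0 0 * v 1 0 - u 1 0 * v 0 0.

Lemma cV2P (R : nmodType) (u v : 'cV[R]_2) :
  u 0 0 = v 0 0 -> u 1 0 = v 1 0 -> u = v.
Proof.
move=> e0 e1; apply/matrixP => i j; rewrite ord1 {j}.
case: i => [[|[|//]] hi].
  by rewrite (_ : Ordinal hi = 0) //; apply: val_inj.
by rewrite (_ : Ordinal hi = 1) //; apply: val_inj.
Qed.

Lemma mulmx_cV2 (R : pzSemiRingType) m (B : 'M[R]_(m, 2)) (z : 'cV[R]_2) i :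
  (B *m z) i 0 = B i 0 * z 0 0 + B i 1 * z 1 0.
Proof.
rewrite mxE !big_ord_recl big_ord0 addr0.
by rewrite (_ : lift ord0 ord0 = 1) //; apply: val_inj.
Qed.

Lemma det_mx2 (R : comPzRingType) (B : 'M[R]_2) :
  \det B = B 0 0 * B 1 1 - B 1 0 * B 0 1.
Proof.
have e1 : lift ord0 ord0 = 1 :> 'I_2 by apply: val_inj.
have e0 : lift 1 ord0 = 0 :> 'I_2 by apply: val_inj.
rewrite (expand_det_row _ 0) !big_ord_recl big_ord0 /cofactor !det_mx11 !mxE.
by rewrite !e1 !e0 /=; ring.
Qed.

Lemma row_mx20 (R : Type) (u v : 'cV[R]_2) i :
  (row_mx u v : 'M[R]_2) i 0 = u i 0.
Proof. by rewrite -(row_mxEl u v); congr (row_mx u v i _); apply: val_inj. Qed.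

Lemma row_mx21 (R : Type) (u v : 'cV[R]_2) i :
  (row_mx u v : 'M[R]_2) i 1 = v i 0.
Proof. by rewrite -(row_mxEr u v); congr (row_mx u v i _); apply: val_inj. Qed.

Lemma det_cross (R : comPzRingType) (u v : 'cV[R]_2) :
  \det (row_mx u v : 'M[R]_2) = cross u v.
Proof. by rewrite det_mx2 !row_mx20 !row_mx21. Qed.

Lemma mul_row_mx_cV2 (R : comPzRingType) (u v z : 'cV[R]_2) :
  (row_mx u v : 'M[R]_2) *m z = z 0 0 *: u + z 1 0 *: v.
Proof.
by apply: cV2P; rewrite mulmx_cV2 row_mx20 row_mx21 !mxE
  ![_ * z _ _]mulrC.
Qed.

Lemma cross_mulmx (R : comPzRingType) (B : 'M[R]_2) (y z : 'cV[R]_2) :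
  cross (B *m y) (B *m z) = \det B * cross y z.
Proof. by rewrite /cross !mulmx_cV2 det_mx2; ring. Qed.

(** Cramer's rule for the coordinates of [x] with respect to [u] and [v], cleared of
    denominators. *)
Lemma cross_scale (R : comPzRingType) (u v x : 'cV[R]_2) :
  cross u v *: x = cross x v *: u + cross u x *: v.
Proof. by apply: cV2P; rewrite !mxE /cross; ring. Qed.

(** * Lattice points in integer coordinates *)

Section LatticePoints.
Variables (R : realType) (L : set 'cV[R]_2).
Implicit Types (B : 'M[R]_2) (u v w x : 'cV[R]_2).

Lemma cross_int_mx (y z : 'cV[int]_2) :
  cross (int_mx R y) (int_mx R z) = (cross y z)%:~R.
Proof. by rewrite /cross !mxE rmorphB /= !rmorphM. Qed.

Lemma int_mx0 m n : int_mx R (0 : 'M[int]_(m, n)) = 0.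
Proof. by apply/matrixP => i j; rewrite !mxE. Qed.

Lemma int_mxD m n (y z : 'M[int]_(m, n)) :
  int_mx R (y + z) = int_mx R y + int_mx R z.
Proof. by apply/matrixP => i j; rewrite !mxE rmorphD. Qed.

Lemma int_mxZ m n (k : int) (z : 'M[int]_(m, n)) :
  int_mx R (k *: z) = k%:~R *: int_mx R z.
Proof. by apply/matrixP => i j; rewrite !mxE rmorphM. Qed.

(** The sign of the determinant is kept as an integer [e], its own inverse, so that it can be
    absorbed into integer coordinates. *)
Lemma unimodular_basis : unimodular_lattice L ->
  exists B (e : int), [/\ lattice_basis L B, \det B = e%:~R & e * e = 1].
Proof.
move=> [_ [B LB dB]]; exists B.
have [d0|d0] := leP 0 (\det B).
  by exists 1; split; rewrite // -dB ger0_norm.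
by exists (- 1); split; rewrite // rmorphN /= -dB ltr0_norm ?opprK.
Qed.

Lemma latticeD u v : lattice L -> L u -> L v -> L (u + v).
Proof.
move=> [B [_ ->]] [y _ <-] [z _ <-].
by exists (y + z); rewrite // int_mxD mulmxDr.
Qed.

Lemma latticeZ (k : int) u : lattice L -> L u -> L (k%:~R *: u).
Proof.
move=> [B [_ ->]] [z _ <-].
by exists (k *: z); rewrite // int_mxZ -scalemxAr.
Qed.

Lemma cross_lattice_int u v : unimodular_lattice L -> L u -> L v ->
  exists k : int, cross u v = k%:~R.
Proof.
move=> /unimodular_basis[B [e [[_ ->] dB _]]] [y _ <-] [z _ <-].
by exists (e * cross y z); rewrite cross_mulmx dB cross_int_mx rmorphM.
Qed.

Lemma primitive_indivisible (n : int) v : primitive L v -> 1 < n -> ~ L (n%:~R^-1 *: v).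
Proof.
move=> [_ v0 hv] n1 Lv.
have n1R : 1 < n%:~R :> R by rewrite -[1]/(1%:~R) ltr_int.
have n0R : 0 < n%:~R :> R by apply: lt_trans n1R.
have : (L `&` [set r *: v | r in `[0, 1[]) (n%:~R^-1 *: v).
  split=> //; exists n%:~R^-1 => //=.
  by rewrite in_itv /= invr_ge0 ltW //= invf_lt1.
rewrite hv => /= /eqP; rewrite scaler_eq0 invr_eq0 (negPf v0) orbF.
by rewrite gt_eqF.
Qed.

Lemma cV2_coprime_multiple (z : 'cV[int]_2) : z != 0 -> exists (g : int) (z' y : 'cV[int]_2),
  [/\ 0 < g, z = g *: z' & cross z' y = 1].
Proof.
move=> z0; pose g := gcdz (z 0 0) (z 1 0).
have g0 : g != 0.
  apply: contraNneq z0 => /eqP; rewrite gcdz_eq0 => /andP[/eqP e0 /eqP e1].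
  by apply/eqP/cV2P; rewrite mxE.
have [c [d /esym cd]] := Bezoutz (z 0 0) (z 1 0).
(* The Bezout relation for the coordinates of [z], with coefficients [c] and [d], says that the
   cross product of [z] with [(- d, c)] is [g]. *)
exists g, (map_mx (divz^~ g) z), (\col_(i < 2) [:: - d; c]`_i).
have z0E : z 0 0 = divz (z 0 0) g * g by rewrite divzK // dvdz_gcdl.
have z1E : z 1 0 = divz (z 1 0) g * g by rewrite divzK // dvdz_gcdr.
split.
- by rewrite lt_def g0.
- by apply: cV2P; rewrite !mxE mulrC.
- apply: (mulIf g0); rewrite mul1r [RHS]cd z0E z1E /cross !mxE /=; ring.
Qed.

(** Dividing the integer coordinates of [x] by their gcd [g] leaves a coprime vector [z']; the
    vector [y] with [cross z' y = 1] certifies that its image is primitive. *)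
Lemma primitive_multiple x : lattice L -> L x -> x != 0 ->
  exists (g : int) p, [/\ 0 < g, primitive L p & x = g%:~R *: p].
Proof.
move=> [B [uB LE]]; rewrite LE => -[z _ <-] x0.
have z0 : z != 0.
  apply: contraNneq x0 => ->; apply/eqP.
  by rewrite int_mx0 mulmx0.
have [g [z' [y [g0 zE z'y]]]] := cV2_coprime_multiple z z0.
exists g, (B *m int_mx R z'); split=> //; last first.
  by rewrite zE int_mxZ -scalemxAr.
have p0 : B *m int_mx R z' != 0.
  apply: contraNneq x0 => p0.
  by rewrite zE int_mxZ -scalemxAr p0 scaler0.
split=> //.
apply/seteqP; split=> [p [[t _ tE] [r /= r01 rE]]|_ ->]; last first.
  split; last by exists 0; rewrite ?scale0r //= in_itv /= lexx ltr01.
  by exists 0 => //; rewrite int_mx0 mulmx0.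
have rz : r *: int_mx R z' = int_mx R t.
  by rewrite -[RHS](mulKmx uB) tE -rE scalemxAr mulKmx.
(* As [cross z' y = 1], pairing [r *: z' = t] with [y] recovers [r], which is thus an integer in
   [[0, 1[]. *)
have rint : r = (cross t y)%:~R.
  rewrite -cross_int_mx -rz -[LHS]mulr1 -[1]/(1%:~R) -z'y -cross_int_mx.
  by rewrite /cross !mxE; ring.
have : r = 0.
  move: r01; rewrite in_itv /= rint -[1]/(1%:~R) ler0z ltr_int => r01.
  by have -> : cross t y = 0 by lia.
by move=> r0; rewrite /= -rE r0 scale0r.
Qed.

(** The integer coordinates of [v] have gcd 1, since otherwise [v / g] would be a lattice point;
    their Bezout vector then gives [u]. *)
Lemma primitive_cross1 v : unimodular_lattice L -> primitive L v ->
  exists2 u, L u & cross v u = 1.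
Proof.
move=> hL pv; have [B [e [[uB LE] dB ee]]] := unimodular_basis hL.
have [Lv v0 _] := pv.
move: (Lv); rewrite LE => -[z _ zE].
have z0 : z != 0.
  apply: contraNneq v0 => z0; rewrite -zE z0; apply/eqP.
  by rewrite int_mx0 mulmx0.
have [g [z' [y [g0 zE' z'y]]]] := cV2_coprime_multiple z z0.
have g1 : g = 1.
  have [g1|g1|//] := ltgtP g 1; first by lia.
  exfalso; apply: (primitive_indivisible g v pv g1).
  rewrite LE; exists z' => //; rewrite -zE zE' int_mxZ -scalemxAr scalerA.
  by rewrite mulVf ?scale1r // intr_eq0 gt_eqF.
(* The factor [e] cancels the determinant of [B]. *)
exists (B *m int_mx R (e *: y)); first by exists (e *: y).
rewrite -zE zE' g1 scale1r cross_mulmx dB cross_int_mx -rmorphM /=.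
have -> : cross z' (e *: y) = e * cross z' y by rewrite /cross !mxE; ring.
by rewrite mulrA ee z'y.
Qed.

(** * Slopes and consecutive points *)

Lemma slope_lt u v : 0 < u 0 0 -> 0 < v 0 0 -> (slope u < slope v) = (0 < cross u v).
Proof.
move=> u0 v0; rewrite /slope /cross ltr_pdivrMr // mulrAC ltr_pdivlMr //.
by rewrite subr_gt0 [v 1 0 * _]mulrC.
Qed.

Lemma slopeZ (k : R) u : k != 0 -> slope (k *: u) = slope u.
Proof. by move=> k0; rewrite /slope !mxE -mulf_div divff // mul1r. Qed.

Variable tau : R.

Lemma consecutive_no_between v w x : lattice L -> consecutive_slopes L tau v w ->
  L x -> 0 < cross v x -> 0 < cross x w -> 0 < x 0 0 -> ~ x 0 0 <= tau.
Proof.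
move=> hL [[_ /= /andP[v0 _]] [_ /= /andP[w0 _]] _ hno] Lx vx xw x0 xtau.
have xN0 : x != 0 by apply: contraTneq x0 => ->; rewrite mxE ltxx.
(* The primitive point [p] has the slope of [x], and [g >= 1] keeps its abscissa within the
   strip. *)
have [g [p [g0 pp xE]]] := primitive_multiple x hL Lx xN0.
have g1R : 1 <= g%:~R :> R by rewrite -[1]/(1%:~R) ler_int; lia.
have g0R : 0 < g%:~R :> R by rewrite ltr0z.
apply: hno; exists p.
  split=> //=; move: x0 xtau; rewrite xE !mxE pmulr_rgt0 // => p0 ptau.
  by apply/andP; split=> //; apply: le_trans ptau; apply: ler_peMl => //; apply: ltW.
rewrite -(slopeZ g%:~R p) ?gt_eqF // -xE.
by rewrite !slope_lt ?vx.
Qed.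

Lemma consecutive_cross1 v w : unimodular_lattice L ->
  consecutive_slopes L tau v w -> cross v w = 1.
Proof.
move=> hL hc; have [[pv /= /andP[v0 vtau]] [pw /= /andP[w0 wtau]] vw _] := hc.
have lL := hL.1.
have [Lv _ _] := pv; have [Lw _ _] := pw.
move: vw; rewrite slope_lt // => vw.
have [n nE] := cross_lattice_int v w hL Lv Lw.
have [u0 Lu0 vu0] := primitive_cross1 v hL pv.
have [m mE] := cross_lattice_int u0 w hL Lu0 Lw.
have n0 : 0 < n by rewrite -(ltr0z R) -nE.
have n0R : 0 < n%:~R :> R by rewrite ltr0z.
have [n1|n1|n1] := ltgtP n 1; [by lia | | by rewrite nE n1].
(* The translate of [u0] along [v] with [0 <= cross u w < n]; then
   [n *: u = cross u w *: v + w] has both coefficients summing to at most [n]. *)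
exfalso; pose u := u0 + (- (m %/ n)%Z)%:~R *: v.
have Lu : L u by apply: latticeD => //; apply: latticeZ.
have vu : cross v u = 1 by rewrite -vu0 /u /cross !mxE; ring.
have uw : cross u w = (m %% n)%Z%:~R.
  rewrite /modz rmorphB rmorphM /= -mE -nE /u /cross !mxE rmorphN /=; ring.
clearbody u; have := cross_scale R v w u; rewrite nE vu uw scale1r => uE.
have [r0|r0] := eqVneq (m %% n)%Z 0.
  apply: (primitive_indivisible n w pw n1).
  move: uE; rewrite r0 scale0r add0r => <-.
  by rewrite scalerA mulVf ?scale1r // gt_eqF.
have rge0 : 0 <= (m %% n)%Z by apply: modz_ge0; rewrite gt_eqF.
have rltn : (m %% n)%Z < n by apply: ltz_pmod.
have rgt0 : 0 < (m %% n)%Z by rewrite lt_def r0.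
have rgt0R : 0 < (m %% n)%Z%:~R :> R by rewrite ltr0z.
have rltnR : (m %% n)%Z%:~R + 1 <= n%:~R :> R.
  by rewrite -[1]/(1%:~R) -rmorphD /= ler_int; lia.
have /matrixP/(_ 0 0) := uE; rewrite !mxE => uE0.
apply: (consecutive_no_between v w u lL hc Lu); rewrite ?vu ?uw //.
  by rewrite -(pmulr_rgt0 _ n0R) uE0 addr_gt0 // mulr_gt0.
(* With [r = m mod n], the abscissa of [n *: u] is at most [(r + 1) * tau <= n * tau]. *)
rewrite -(ler_pM2l n0R) uE0; nra.
Qed.

(** By Cramer's rule with determinant 1, the coordinates of a lattice point [x] are [cross x w] and
    [cross v x], both integers by unimodularity. *)
Lemma cross1_basis v w : unimodular_lattice L -> L v -> L w -> cross v w = 1 ->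
  positively_oriented_basis L v w.
Proof.
move=> hL Lv Lw vw; have lL := hL.1; split; last by rewrite det_cross vw.
split; first by rewrite unitmxE det_cross vw unitr1.
apply/seteqP; split=> [x Lx|_ [z _ <-]]; last first.
  by rewrite mul_row_mx_cV2 !mxE; apply: (latticeD _ _ lL); exact: latticeZ.
have [c cE] := cross_lattice_int x w hL Lx Lw.
have [d dE] := cross_lattice_int v x hL Lv Lx.
exists (\col_(i < 2) [:: c; d]`_i) => //.
by rewrite mul_row_mx_cV2 !mxE /= -cE -dE -cross_scale vw scale1r.
Qed.

End LatticePoints.

(** A small vertical move of [p] either way stays in the triangle, which makes both slope
    inequalities strict. The bound on the abscissa stays weak, which suffices as the strip contains
    its edge [x = tau]. *)
Lemma interior_triangle (R : realType) (s t tau : R) (p : 'cV[R]_2) :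
  interior (triangle s t tau) p ->
  [/\ s * p 0 0 < p 1 0, p 1 0 < t * p 0 0 & p 0 0 <= tau].
Proof.
move=> ip; have [_ /andP[_ ptau]] := interior_subset ip.
pose f (r : R) : 'cV[R]_2 := p + r *: delta_mx 1 0.
have cf : f r @[r --> 0] --> p.
  rewrite -[X in _ --> X](addr0 p) -(scale0r (delta_mx 1 0)).
  apply: cvgD; first exact: cvg_cst.
  apply: cvgZr_tmp; exact: cvg_id.
have /nbhs_ballP[e /= e0 he] := cf _ ip.
have d0 : 0 < e / 2 by rewrite divr_gt0.
have b r : `|r| = e / 2 -> triangle s t tau (f r).
  move=> re; apply: he; rewrite /ball /= sub0r normrN re; lra.
have [] := b (e / 2); first by rewrite gtr0_norm.
have [] := b (- (e / 2)); first by rewrite normrN gtr0_norm.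
rewrite /f !mxE /= !(mulr0, mulr1, addr0) => h1 _ h2 _.
by split=> //; lra.
Qed.

Theorem lemma4 (R : realType) (L : set 'cV[R]_2) (tau q1 a1 q2 a2 : R)
    (hL : unimodular_lattice L) (htau : 0 < tau)
    (hF : farey_points L tau !=set0)
    (h1 : farey_points L tau (vec2 q1 a1))
    (h2 : farey_points L tau (vec2 q2 a2))
    (hcons : consecutive_slopes L tau (vec2 q1 a1) (vec2 q2 a2)) :
  [/\ (0 < q1 <= tau) /\ (0 < q2 <= tau),
      L `&` interior (triangle (a1 / q1) (a2 / q2) tau) = set0,
      q1 + q2 > tau,
      positively_oriented_basis L (vec2 q1 a1) (vec2 q2 a2) &
      a2 * q1 - a1 * q2 = 1 /\ a2 / q2 = a1 / q1 + 1 / (q1 * q2)].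
Proof.
have q1P : 0 < q1 <= tau by case: h1 => _; rewrite /strip /= !mxE.
have q2P : 0 < q2 <= tau by case: h2 => _; rewrite /strip /= !mxE.
have [[[L1 _ _] _] [[L2 _ _] _]] := (h1, h2).
have /andP[q10 _] := q1P; have /andP[q20 _] := q2P.
have c1 := consecutive_cross1 R L tau _ _ hL hcons.
have e1 : a2 * q1 - a1 * q2 = 1.
  by rewrite -c1 /cross !mxE /= [q1 * _]mulrC.
have no := consecutive_no_between R L tau _ _ _ hL.1 hcons.
split=> //.
- apply/seteqP; split=> // p [Lp /interior_triangle[sp pt ptau]] /=.
  rewrite mulrAC ltr_pdivrMr // in sp.
  rewrite mulrAC ltr_pdivlMr // in pt.
  apply: (no p Lp) => //; rewrite /cross ?mxE /= ?subr_gt0.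
  + by rewrite [q1 * _]mulrC.
  + by rewrite [p 0 0 * _]mulrC.
  (* Chaining [sp] times [q2] with [pt] times [q1] gives
     [0 < (a2 * q1 - a1 * q2) * p 0 0 = p 0 0]. *)
  + nra.
- rewrite ltNge; apply/negP => le.
  apply: (no (vec2 q1 a1 + vec2 q2 a2)); rewrite /cross ?mxE /= //.
  + by apply: latticeD => //; exact: hL.1.
  (* Both cross products with the sum reduce to [a2 * q1 - a1 * q2 = 1]. *)
  + nra.
  + nra.
  + lra.
- exact: cross1_basis.
- split=> //; rewrite -e1; field; rewrite !gt_eqF //.
Qed.
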